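(* Let $G,G'$ be additive subgroups of $\mathbb C$, each containing $\mathbb Z$ and containing $\frac1k$ for no integer $k>1$, and let $\lambda,\lambda'\in\mathbb C$. The Lie algebras $\mathfrak g(G,\lambda)$ and $\mathfrak g(G',\lambda')$ are isomorphic if and only if $\lambda'=\lambda$ and $G'=\xi G$ for some nonzero $\xi\in\mathbb C$. Moreover, for such a $\xi$ (nonzero, with $G'=\xi G$), any Lie algebra isomorphism $\pi:\mathfrak g(G,\lambda)\to\mathfrak g(\xi G,\lambda)$, aside from an inner automorphism of $\mathfrak g(\xi G,\lambda)$ (that is, after composing $\pi$ with a suitable inner automorphism of $\mathfrak g(\xi G,\lambda)$), has the form, for all $a\in G$, $$\pi(L_a)=\xi^{-1}\chi(a)L'_{\xi a}+\chi(a)\big(l_0\delta_{\lambda,0}+l_1a+l_2a^2\delta_{\lambda,-1}+l_3a^3\delta_{\lambda,-2}+f(a)\delta_{\lambda,1}\big)I'_{\xi a},$$ $$\pi(I_a)=l\,\chi(a)\,I'_{\xi a},$$ where $l\in\mathbb C^\times$, $l_0,l_1,l_2,l_3\in\mathbb C$, $\chi$ is a character of $G$, and $f\in\mathrm{Hom}(G,\mathbb C)$.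
   Context: For an additive subgroup $G\subseteq\mathbb C$ and $\lambda\in\mathbb C$, $\mathfrak g(G,\lambda)$ is the complex Lie algebra with basis $\{L_a,I_a\mid a\in G\}$ and brackets $[L_a,L_b]=(b-a)L_{a+b}$, $[L_a,I_b]=(b-\lambda a)I_{a+b}$, $[I_a,I_b]=0$. The basis elements of $\mathfrak g(G',\lambda')$, and in particular of $\mathfrak g(\xi G,\lambda)$, are written $L'_b,I'_b$. A character of $G$ is a group homomorphism $G\to\mathbb C^\times$; $\mathrm{Hom}(G,\mathbb C)$ is the set of additive group homomorphisms $G\to\mathbb C$; $\mathbb C^\times$ is the set of nonzero complex numbers; $\delta$ is the Kronecker delta. Inner automorphisms of $\mathfrak g(\xi G,\lambda)$ are the elements of the group generated by the automorphisms $\exp(c\,\mathrm{ad}\,I'_b)$, $b\in\xi G$, $c\in\mathbb C$.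
   Formalization: In the ''Moreover'' part ξ is not fixed in advance: for each isomorphism π there is a nonzero ξ with G'=ξG, depending on π, for which the form holds. With ξ fixed the claim fails: for G=ℤ, ξ=1, π(L_a)=−L_{−a}, π(I_a)=I_{−a} has the form only with ξ=−1. *)

(* Defs.v *)
From HB Require Import structures.
From mathcomp Require Import all_boot all_order all_algebra.
From mathcomp Require Import finmap monalg ring.

Set Implicit Arguments.
Unset Strict Implicit.
Unset Printing Implicit Defensive.

Import GRing.Theory.
Local Open Scope ring_scope.

HB.mixin Record Lmodule_isLieAlgebra (K : fieldType) V of GRing.Lmodule K V := {
  lie : V -> V -> V;
  lie_linearl : forall y, linear (lie ^~ y);
  lie_linearr : forall x, linear (lie x);
  liexx : forall x, lie x x = 0;
  lie_jacobi : forall x y z,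
    lie x (lie y z) + lie y (lie z x) + lie z (lie x y) = 0
}.

#[short(type="lieAlgType")]
HB.structure Definition LieAlgebra (K : fieldType) :=
  { V of GRing.Lmodule K V & Lmodule_isLieAlgebra K V }.

Arguments lie {K s} x y : rename.

Notation "[ 'lie' x , y ]" := (lie x y)
  (at level 0, format "[ 'lie'  x ,  y ]") : ring_scope.

Definition lie_iso (K : fieldType) (V W : lieAlgType K) (f : V -> W) : Prop :=
  [/\ linear f, {morph f : x y / [lie x, y]} & bijective f].

(* [is_exp D E]: [D] is locally nilpotent and [E] is its exponential.  Any
   [N] with [D^N x = 0] gives the same sum, as the later terms vanish. *)
Definition is_exp (K : fieldType) (V : lmodType K) (D E : V -> V) : Prop :=
  forall x, exists2 N : nat, iter N D x = 0 &
    E x = \sum_(n < N) (n`!%:R : K)^-1 *: iter n D x.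

Section Subgroup.
Variables (V : zmodType) (G : zmodClosed V).

Record subgrp := SubGrp { subgrp_val : V; _ : subgrp_val \in G }.

HB.instance Definition _ := [isSub for subgrp_val].
HB.instance Definition _ := [Choice of subgrp by <:].
HB.instance Definition _ := [SubChoice_isSubZmodule of subgrp by <:].

End Subgroup.

Definition scaled (K : fieldType) (xi : K) (G G' : zmodClosed K) : Prop :=
  forall z, z \in G' <-> exists2 a, a \in G & z = xi * a.

Definition contains_int (K : fieldType) (G : zmodClosed K) : Prop :=
  forall m : int, m%:~R \in G.

Definition no_unit_fraction (K : fieldType) (G : zmodClosed K) : Prop :=
  forall k : int, 1 < k -> (k%:~R : K)^-1 \notin G.

Definition character (K : fieldType) (A : zmodType) (chi : A -> K) : Prop :=
  (forall a, chi a != 0) /\ {morph chi : a b / a + b >-> a * b}.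

Section Bilinear.
Variables (K : fieldType) (T : choiceType) (br : T -> T -> {malg K[T]}).

Definition malg_bilin (x y : {malg K[T]}) : {malg K[T]} :=
  \sum_(i <- msupp x) \sum_(j <- msupp y) (x@_i * y@_j) *: br i j.

Lemma malg_bilinEw (d e : {fset T}) x y :
  (msupp x `<=` d)%fset -> (msupp y `<=` e)%fset ->
  malg_bilin x y = \sum_(i <- d) \sum_(j <- e) (x@_i * y@_j) *: br i j.
Proof.
move=> xd ye; rewrite /malg_bilin (big_fset_incl _ xd) /=.
  apply: eq_bigr => i _; apply: big_fset_incl => // j _ /mcoeff_outdom ->.
  by rewrite mulr0 scale0r.
move=> i _ /mcoeff_outdom xi0; rewrite big1 // => j _.
by rewrite xi0 mul0r scale0r.
Qed.

Lemma malg_bilin_linearl y : linear (malg_bilin ^~ y).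
Proof.
move=> c x x'; pose d := (msupp (c *: x + x') `|` (msupp x `|` msupp x'))%fset.
have s0 : (msupp (c *: x + x') `<=` d)%fset by apply: fsubsetUl.
have s1 : (msupp x `<=` d)%fset by rewrite /d fsetUCA fsubsetUl.
have s2 : (msupp x' `<=` d)%fset.
  by rewrite /d [(msupp x `|` _)%fset]fsetUC fsetUCA fsubsetUl.
rewrite (malg_bilinEw s0 (fsubset_refl _)) (malg_bilinEw s1 (fsubset_refl _)).
rewrite (malg_bilinEw s2 (fsubset_refl _)) scaler_sumr -big_split /=.
apply: eq_bigr => i _; rewrite scaler_sumr -big_split /=.
apply: eq_bigr => j _.
by rewrite mcoeffD mcoeffZ mulrDl scalerDl -mulrA scalerA.
Qed.

Lemma malg_bilin_linearr x : linear (malg_bilin x).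
Proof.
move=> c y y'; pose d := (msupp (c *: y + y') `|` (msupp y `|` msupp y'))%fset.
have s0 : (msupp (c *: y + y') `<=` d)%fset by apply: fsubsetUl.
have s1 : (msupp y `<=` d)%fset by rewrite /d fsetUCA fsubsetUl.
have s2 : (msupp y' `<=` d)%fset.
  by rewrite /d [(msupp y `|` _)%fset]fsetUC fsetUCA fsubsetUl.
rewrite (malg_bilinEw (fsubset_refl _) s0) (malg_bilinEw (fsubset_refl _) s1).
rewrite (malg_bilinEw (fsubset_refl _) s2) scaler_sumr -big_split /=.
apply: eq_bigr => i _; rewrite scaler_sumr -big_split /=.
apply: eq_bigr => j _.
by rewrite mcoeffD mcoeffZ mulrDr scalerDl mulrCA scalerA.
Qed.

Lemma malg_bilinU i j : malg_bilin << i >> << j >> = br i j.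
Proof.
rewrite (malg_bilinEw msuppU_le msuppU_le) !big_seq_fset1 !mcoeffUU mulr1.
by rewrite scale1r.
Qed.

Lemma malg_ind (P : {malg K[T]} -> Prop) :
  P 0 -> (forall c i x, P x -> P (c *: << i >> + x)) -> forall x, P x.
Proof.
move=> P0 PS x; rewrite [x]monalgE; elim: (enum_fset _) => [|i s IH].
  by rewrite big_nil.
rewrite big_cons.
suff -> : << x@_i *g i >> = x@_i *: << i >> :> {malg K[T]} by apply: PS.
by apply/malgP => k; rewrite mcoeffZ !mcoeffU mulrnAr mulr1.
Qed.

End Bilinear.

(* Free module on the disjoint union of two copies of [G]. *)
Definition glie (K : fieldType) (G : zmodClosed K) (lambda : K) : Type :=
  {malg K[(subgrp G + subgrp G)%type]}.

HB.instance Definition _ (K : fieldType) (G : zmodClosed K) (lambda : K) :=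
  GRing.Lmodule.on (glie G lambda).

(* Locked, as unifying two distinct basis elements would otherwise unfold
   finitely supported functions. *)
HB.lock Definition gL (K : fieldType) (G : zmodClosed K) (lambda : K)
  (a : subgrp G) : glie G lambda := << inl a >>.

HB.lock Definition gI (K : fieldType) (G : zmodClosed K) (lambda : K)
  (a : subgrp G) : glie G lambda := << inr a >>.

Section GLambda.
Variables (K : fieldType) (G : zmodClosed K) (lambda : K).

Local Notation glie := (glie G lambda).
Local Notation gL := (@gL K G lambda).
Local Notation gI := (@gI K G lambda).

Definition gbr (u v : subgrp G + subgrp G) : glie :=
  match u, v with
  | inl a, inl b => (val b - val a) *: gL (a + b)
  | inl a, inr b => (val b - lambda * val a) *: gI (a + b)
  | inr a, inl b => - ((val a - lambda * val b) *: gI (b + a))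
  | inr _, inr _ => 0
  end.

Definition glie_bracket (x y : glie) : glie := malg_bilin gbr x y.

Let bl y : linear (glie_bracket ^~ y) := malg_bilin_linearl gbr y.
Let br x : linear (glie_bracket x) := malg_bilin_linearr gbr x.

Let b0l y : glie_bracket 0 y = 0.
Proof. by have := bl y (-1) 0 0; rewrite scaler0 addr0 scaleN1r addNr. Qed.
Let b0r x : glie_bracket x 0 = 0.
Proof. by have := br x (-1) 0 0; rewrite scaler0 addr0 scaleN1r addNr. Qed.
Let bDl y u v : glie_bracket (u + v) y = glie_bracket u y + glie_bracket v y.
Proof. by have := bl y 1 u v; rewrite !scale1r. Qed.
Let bDr x u v : glie_bracket x (u + v) = glie_bracket x u + glie_bracket x v.
Proof. by have := br x 1 u v; rewrite !scale1r. Qed.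
Let bZl y c u : glie_bracket (c *: u) y = c *: glie_bracket u y.
Proof. by have := bl y c u 0; rewrite !addr0 b0l addr0. Qed.
Let bZr x c u : glie_bracket x (c *: u) = c *: glie_bracket x u.
Proof. by have := br x c u 0; rewrite !addr0 b0r addr0. Qed.
Let bNr x u : glie_bracket x (- u) = - glie_bracket x u.
Proof. by rewrite -scaleN1r bZr scaleN1r. Qed.

Lemma glie_bracketU i j : glie_bracket << i >> << j >> = gbr i j.
Proof. exact: malg_bilinU. Qed.

Let bLL a b : glie_bracket (gL a) (gL b) = (val b - val a) *: gL (a + b).
Proof. by rewrite {1 2}gL.unlock glie_bracketU. Qed.
Let bLI a b :
  glie_bracket (gL a) (gI b) = (val b - lambda * val a) *: gI (a + b).
Proof. by rewrite {1}gL.unlock {1}gI.unlock glie_bracketU. Qed.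
Let bIL a b :
  glie_bracket (gI a) (gL b) = - ((val a - lambda * val b) *: gI (b + a)).
Proof. by rewrite {1}gL.unlock {1}gI.unlock glie_bracketU. Qed.
Let bII a b : glie_bracket (gI a) (gI b) = 0.
Proof. by rewrite gI.unlock glie_bracketU. Qed.

Lemma gbr_anti i j : gbr i j = - gbr j i.
Proof.
case: i => a; case: j => b /=; rewrite ?opprK ?oppr0 //.
by rewrite [b + a]addrC -scaleNr opprB.
Qed.

Lemma gbrxx i : gbr i i = 0.
Proof. by case: i => a //=; rewrite subrr scale0r. Qed.

Lemma glie_anti x y : glie_bracket x y = - glie_bracket y x.
Proof.
elim/malg_ind: x => [|c i x IH]; first by rewrite b0l b0r oppr0.
rewrite bDl bZl bDr bZr opprD IH; congr (_ + _); rewrite -scalerN; congr (_ *: _).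
elim/malg_ind: y {IH} => [|d j y IH]; first by rewrite b0l b0r oppr0.
by rewrite bDl bZl bDr bZr opprD IH -scalerN !glie_bracketU gbr_anti.
Qed.

Lemma gliexx x : glie_bracket x x = 0.
Proof.
elim/malg_ind: x => [|c i x IH]; first by rewrite b0l.
rewrite bDl !bDr IH !bZl !bZr glie_bracketU gbrxx !scaler0 add0r addr0.
by rewrite [X in _ + _ *: X]glie_anti scalerN addrN.
Qed.

Let J x y z := glie_bracket x (glie_bracket y z) +
  glie_bracket y (glie_bracket z x) + glie_bracket z (glie_bracket x y).

Let JC x y z : J x y z = J y z x.
Proof. by rewrite /J [RHS]addrC addrA. Qed.

Let add3ACA (V : zmodType) (p q r p' q' r' : V) :
  p + p' + (q + q') + (r + r') = p + q + r + (p' + q' + r').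
Proof. by rewrite [RHS]addrACA; congr (_ + _); apply: addrACA. Qed.

Let JS y z c i x : J (c *: i + x) y z = c *: J i y z + J x y z.
Proof.
rewrite /J !(bDl, bDr, bZl, bZr) !scalerDr.
exact: add3ACA.
Qed.

Let J0 y z : J 0 y z = 0.
Proof. by rewrite /J !(b0l, b0r) !addr0. Qed.

Let collect (V : lmodType K) (p q r : K) (v : V) :
  p + q + r = 0 -> p *: v + q *: v + r *: v = 0.
Proof. by move=> e; rewrite -!scalerDl e scale0r. Qed.

Let JLLL a b c : J (gL a) (gL b) (gL c) = 0.
Proof.
have e1 : b + (c + a) = a + (b + c) by rewrite addrA addrC.
have e2 : c + (a + b) = a + (b + c) by rewrite addrC addrA.
rewrite /J !bLL !bZr !bLL.
rewrite e1 e2.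
rewrite !scalerA.
apply: collect.
rewrite !raddfD /=; ring.
Qed.

Let JLLI a b c : J (gL a) (gL b) (gI c) = 0.
Proof.
have e1 : b + (a + c) = a + (b + c) by rewrite addrCA.
have e2 : a + b + c = a + (b + c) by rewrite addrA.
rewrite /J !bLL bIL bNr !bLI !bZr !bLI bIL e1 e2.
rewrite -scalerN -!scaleNr !scalerA; apply: collect.
by rewrite !raddfD /=; ring.
Qed.

Let JLII a b c : J (gL a) (gI b) (gI c) = 0.
Proof. by rewrite /J !(bII, bLI, bIL, bZr, bNr, b0r, scaler0, oppr0) !addr0. Qed.

Let JIII a b c : J (gI a) (gI b) (gI c) = 0.
Proof. by rewrite /J !(bII, b0r) !addr0. Qed.

Let JUUU i j k : J << i >> << j >> << k >> = 0.
Proof.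
have eL a : << inl a >> = gL a by rewrite gL.unlock.
have eI a : << inr a >> = gI a by rewrite gI.unlock.
case: i j k => a [] b [] c; rewrite !(eL, eI).
- exact: JLLL.
- exact: JLLI.
- by rewrite JC JC JLLI.
- exact: JLII.
- by rewrite JC JLLI.
- by rewrite JC JLII.
- by rewrite JC JC JLII.
- exact: JIII.
Qed.

Lemma glie_jacobi x y z : glie_bracket x (glie_bracket y z) +
  glie_bracket y (glie_bracket z x) + glie_bracket z (glie_bracket x y) = 0.
Proof.
rewrite -/(J x y z).
elim/malg_ind: x => [|r i x IHx]; first exact: J0.
rewrite JS IHx addr0 JC -[RHS](scaler0 _ r); congr (_ *: _) => {x IHx}.
elim/malg_ind: y => [|s j y IHy]; first exact: J0.
rewrite JS IHy addr0 JC -[RHS](scaler0 _ s); congr (_ *: _) => {y IHy}.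
elim/malg_ind: z => [|t k z IHz]; first exact: J0.
rewrite JS IHz addr0 JC -[RHS](scaler0 _ t); congr (_ *: _) => {z IHz}.
exact: JUUU.
Qed.

HB.instance Definition _ := Lmodule_isLieAlgebra.Build K glie
  bl br gliexx glie_jacobi.

Lemma lie_gLL a b : [lie gL a, gL b] = (val b - val a) *: gL (a + b).
Proof. exact: bLL. Qed.

Lemma lie_gLI a b : [lie gL a, gI b] = (val b - lambda * val a) *: gI (a + b).
Proof. exact: bLI. Qed.

Lemma lie_gII a b : [lie gI a, gI b] = 0.
Proof. exact: bII. Qed.

(* The group generated by the automorphisms [exp (c ad I_b)]. *)
Inductive inner_aut : (glie -> glie) -> Prop :=
| inner_exp c b E of is_exp (fun x => c *: [lie gI b, x]) E : inner_aut E
| inner_id : inner_aut id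
| inner_comp s t of inner_aut s & inner_aut t : inner_aut (s \o t)
| inner_inv s t of inner_aut s & cancel s t & cancel t s : inner_aut t.

End GLambda.

(* Main.v *)
Require Import Defs.
From HB Require Import structures.
From mathcomp Require Import all_boot all_order all_algebra.
From mathcomp Require Import finmap monalg ring.
From mathcomp Require Import complex reals.

Set Implicit Arguments.
Unset Strict Implicit.
Unset Printing Implicit Defensive.

Import Order.TTheory GRing.Theory Num.Theory.
Local Open Scope ring_scope.

(** Let [pi] be an isomorphism from [g(G, lambda)] to [g(G', lambda')].

    The image of [L_0]. The operator [ad L_0] is diagonalizable, with [L_a] and
    [I_a] of eigenvalue [a], so [x = pi L_0] is [ad]-diagonalizable too. Choose
    a group order on [G'] and suppose that the [L]-part of [x] has a top term of
    degree [M > 0]. If [n] is the top degree of the [L]-part of [y], the term of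
    degree [M + n] in [[x, y]] vanishes only for [n = M]; hence the eigenvectors
    of [ad x] with nonzero [L]-part all have top degree [M], and they cannot span
    [L_2M]. With the opposite order as well, the [L]-part of [x] is [zeta L_0]
    ([ad_diagonalizable_lc]), and [zeta] is nonzero because the span of the [I_b]
    is an abelian ideal ([lc_iso_gL0]). Since [[I_d, L_0] = - d I_d] and any
    product of two of the [ad I_d] is zero, a product of their exponentials
    removes every [I_d] with [d != 0] ([inner_straighten]): after an inner
    automorphism, [rho L_0 = zeta L_0 + c I_0].

    Weights. Every eigenvector of [ad (zeta L_0 + c I_0)] for the eigenvalue [a]
    is a combination of [L_u] and [I_u] with [u = xi a] and [xi = zeta^-1]
    ([straight_weight]). This gives [G' = xi G] ([straight_scaled]) and four
    coefficient functions
      [rho L_a = p(a) L_u + q(a) I_u],  [rho I_a = r(a) L_u + m(a) I_u].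
    The three families of brackets become functional equations. They force
    [r = 0], make [chi = xi p] a character, give
    [chi(a) m(b) (b - lambda' a) = (b - lambda a) m(a + b)], whence
    [lambda' = lambda] and [m = m(0) chi] ([weight_module_twist]), and say that
    [c = q / chi] satisfies
      [(b - lambda a) c(b) - (a - lambda b) c(a) = (b - a) c(a + b)].

    The last equation. If [lambda] is not [1], [-1] or [-2], eliminating
    [c(a + b)] between two instances shows that [c] is linear up to the constant
    [c(0)], which vanishes unless [lambda = 0]. If [lambda = 1], the equation
    says that [c] is additive. For [-1] and [-2] one subtracts a combination of
    [a] and [a^2], respectively [a^3], that agrees with [c] at two points, and a
    few instances show that the difference is zero
    ([weight_cocycle_classification]).

    Conversely, for [G' = xi G] the map sending [L_a] to [xi^-1 L_(xi a)] and
    [I_a] to [I_(xi a)] is an isomorphism ([rescaling_iso]). *)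

(** * Linear maps and Lie algebras *)

Section Linear.
Variables (K : fieldType) (V W : lmodType K) (f : V -> W).
Hypothesis lf : linear f.

Let F : {linear V -> W} := HB.pack f (GRing.isLinear.Build K V W *:%R f lf).

Lemma lin0 : f 0 = 0. Proof. exact: (linear0 F). Qed.

Lemma linD u v : f (u + v) = f u + f v. Proof. exact: (linearD F). Qed.

Lemma linB u v : f (u - v) = f u - f v. Proof. exact: (linearB F). Qed.

Lemma linZ c u : f (c *: u) = c *: f u. Proof. exact: (linearZ_LR F). Qed.

Lemma lin_sum (I : Type) (s : seq I) (u : I -> V) :
  f (\sum_(i <- s) u i) = \sum_(i <- s) f (u i).
Proof. exact: (linear_sum F). Qed.

End Linear.

Section LieTheory.
Variables (K : fieldType) (V : lieAlgType K).
Implicit Types x y z : V.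

Lemma lieDl x y z : [lie x + y, z] = [lie x, z] + [lie y, z].
Proof. exact: linD (lie_linearl z) x y. Qed.

Lemma lieDr x y z : [lie z, x + y] = [lie z, x] + [lie z, y].
Proof. exact: linD (lie_linearr z) x y. Qed.

Lemma lieZl c x y : [lie c *: x, y] = c *: [lie x, y].
Proof. exact: linZ (lie_linearl y) c x. Qed.

Lemma lieZr c x y : [lie x, c *: y] = c *: [lie x, y].
Proof. exact: linZ (lie_linearr x) c y. Qed.

Lemma lie0r x : [lie x, 0] = 0. Proof. exact: lin0 (lie_linearr x). Qed.

Lemma lie_anti x y : [lie x, y] = - [lie y, x].
Proof.
have := liexx (x + y); rewrite lieDl !lieDr !liexx add0r addr0.
by move/eqP; rewrite addr_eq0 => /eqP.
Qed.

Lemma lieNr x y : [lie x, - y] = - [lie x, y].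
Proof. by rewrite -scaleN1r lieZr scaleN1r. Qed.

Lemma lie_der x y z :
  [lie x, [lie y, z]] = [lie [lie x, y], z] + [lie y, [lie x, z]].
Proof.
have /eqP := lie_jacobi x y z; rewrite -addrA addr_eq0 => /eqP ->.
by rewrite [[lie z, x]]lie_anti lieNr [[lie z, _]]lie_anti -opprD opprK addrC.
Qed.

Definition ad_diagonalizable x := forall y, exists2 s : seq V,
  (forall v, v \in s -> exists mu : K, [lie x, v] = mu *: v) &
  y = \sum_(v <- s) v.

End LieTheory.

Section IsoTheory.
Variables (K : fieldType).

Lemma lie_iso_id (V : lieAlgType K) : lie_iso (@id V).
Proof. by split=> //; exists id. Qed.

Lemma lie_iso_comp (U V W : lieAlgType K) (f : V -> W) (g : U -> V) :
  lie_iso f -> lie_iso g -> lie_iso (f \o g).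
Proof.
move=> [lf mf bf] [lg mg bg]; split; last exact: bij_comp.
- by move=> c x y /=; rewrite lg lf.
- by move=> x y /=; rewrite mg mf.
Qed.

Lemma lie_iso_ad_diagonalizable (V W : lieAlgType K) (f : V -> W) x :
  lie_iso f -> ad_diagonalizable x -> ad_diagonalizable (f x).
Proof.
move=> [lf mf [g fK gK]] dx y; have [s sE e] := dx (g y).
exists (map f s); last by rewrite big_map -lin_sum // -e gK.
move=> _ /mapP[v vs ->]; have [mu e'] := sE v vs.
by exists mu; rewrite -mf e' linZ.
Qed.

Lemma lie_iso_injective (V W : lieAlgType K) (f : V -> W) :
  lie_iso f -> forall x, f x = 0 -> x = 0.
Proof.
move=> [lf mf /bij_inj fI] x; rewrite -(lin0 lf); exact: fI.
Qed.

End IsoTheory.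

(** Here [exp D = 1 + D]. If [D] is a derivation, this map fails to preserve the
    bracket only by the quadratic term [[D x, D y]], and its inverse is
    [1 - D]. *)
Section SquareZero.
Variables (K : fieldType) (V : lieAlgType K) (D : V -> V).
Hypothesis (lD : linear D) (DD : forall x, D (D x) = 0).

Lemma is_exp_square_zero : is_exp D (fun x => x + D x).
Proof.
move=> x; exists 2; first by rewrite /= DD.
by rewrite big_ord_recl big_ord1 /= !invr1 !scale1r.
Qed.

Lemma lie_iso_square_zero :
    (forall x y, D [lie x, y] = [lie D x, y] + [lie x, D y]) ->
    (forall x y, [lie D x, D y] = 0) ->
  lie_iso (fun x => x + D x).
Proof.
move=> der ab; split.
- by move=> c x y; rewrite lD scalerDr addrACA.
- by move=> x y; rewrite der lieDl !lieDr ab addr0 addrAC addrA.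
exists (fun x => x - D x) => x.
- by rewrite linD // DD addr0 addrK.
- by rewrite linB // DD subr0 subrK.
Qed.

End SquareZero.

(** * Coordinates in the algebra [g(G, lambda)] *)

Section SubgroupVal.
Variables (V : zmodType) (G : zmodClosed V).
Implicit Types a b : subgrp G.

Lemma val_subgrp0 : val (0 : subgrp G) = 0. Proof. by rewrite raddf0. Qed.

Lemma val_subgrpD a b : val (a + b) = val a + val b.
Proof. by rewrite raddfD. Qed.

Lemma val_subgrpN a : val (- a) = - val a. Proof. by rewrite raddfN. Qed.

Lemma val_subgrp_eq0 a : (val a == 0) = (a == 0).
Proof. by rewrite -val_subgrp0 (inj_eq val_inj). Qed.

End SubgroupVal.

Section Coefficients.
Variables (K : fieldType) (G : zmodClosed K) (lambda : K).

Local Notation g := (glie G lambda).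
Local Notation S := (subgrp G).
Local Notation gL := (@gL K G lambda).
Local Notation gI := (@gI K G lambda).
Implicit Types (x y z : g) (a b c : S).

Definition lc x a : K := mcoeff (inl a) x.
Definition ic x a : K := mcoeff (inr a) x.

Lemma glieP x y : lc x =1 lc y -> ic x =1 ic y -> x = y.
Proof. by move=> el ei; apply/malgP => -[a|a]; [exact: el | exact: ei]. Qed.

Lemma lcD x y a : lc (x + y) a = lc x a + lc y a. Proof. exact: mcoeffD. Qed.
Lemma icD x y a : ic (x + y) a = ic x a + ic y a. Proof. exact: mcoeffD. Qed.
Lemma lcZ k x a : lc (k *: x) a = k * lc x a. Proof. exact: mcoeffZ. Qed.
Lemma icZ k x a : ic (k *: x) a = k * ic x a. Proof. exact: mcoeffZ. Qed.
Lemma lc0 a : lc 0 a = 0. Proof. exact: mcoeff0. Qed.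
Lemma ic0 a : ic 0 a = 0. Proof. exact: mcoeff0. Qed.
Lemma lcN x a : lc (- x) a = - lc x a. Proof. exact: mcoeffN. Qed.

Lemma lc_comb k x k' y a : lc (k *: x + k' *: y) a = k * lc x a + k' * lc y a.
Proof. exact: etrans (lcD _ _ _) (congr2 +%R (lcZ _ _ _) (lcZ _ _ _)). Qed.
Lemma ic_comb k x k' y a : ic (k *: x + k' *: y) a = k * ic x a + k' * ic y a.
Proof. exact: etrans (icD _ _ _) (congr2 +%R (icZ _ _ _) (icZ _ _ _)). Qed.

Lemma lc_sum (T : Type) (s : seq T) (F : T -> g) a :
  lc (\sum_(i <- s) F i) a = \sum_(i <- s) lc (F i) a.
Proof. exact: (raddf_sum (mcoeff (inl a))). Qed.

Lemma ic_sum (T : Type) (s : seq T) (F : T -> g) a :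
  ic (\sum_(i <- s) F i) a = \sum_(i <- s) ic (F i) a.
Proof. exact: (raddf_sum (mcoeff (inr a))). Qed.

Lemma lc_gL a b : lc (gL a) b = (a == b)%:R.
Proof. by rewrite gL.unlock /lc mcoeffU. Qed.
Lemma lc_gI a b : lc (gI a) b = 0.
Proof. by rewrite gI.unlock /lc mcoeffU. Qed.
Lemma ic_gL a b : ic (gL a) b = 0.
Proof. by rewrite gL.unlock /ic mcoeffU. Qed.
Lemma ic_gI a b : ic (gI a) b = (a == b)%:R.
Proof. by rewrite gI.unlock /ic mcoeffU. Qed.

Definition lcE := (lcD, lcZ, lcN, lc0, lc_gL, lc_gI).

Definition basis_vec (i : S + S) : g :=
  match i with inl a => gL a | inr a => gI a end.

Lemma basis_vecE i : basis_vec i = << i >>.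
Proof. by case: i => a /=; rewrite ?gL.unlock ?gI.unlock. Qed.

Lemma glie_expand x :
  x = \sum_(i <- msupp (x : {malg K[_]})) mcoeff i x *: basis_vec i.
Proof.
rewrite {1}[x]monalgE; apply: eq_bigr => i _; rewrite basis_vecE.
by apply/malgP => k; rewrite mcoeffZ !mcoeffU mulrnAr mulr1.
Qed.

Lemma glie_ind (P : g -> Prop) :
  P 0 -> (forall k a x, P x -> P (k *: gL a + x)) ->
  (forall k a x, P x -> P (k *: gI a + x)) -> forall x, P x.
Proof.
move=> P0 PL PI; apply: malg_ind => // c [a|a] x Px.
- by have := PL c a x Px; rewrite gL.unlock.
- by have := PI c a x Px; rewrite gI.unlock.
Qed.

Lemma glie_lin_eq (W : lmodType K) (f h : g -> W) : linear f -> linear h ->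
  (forall a, f (gL a) = h (gL a)) -> (forall a, f (gI a) = h (gI a)) -> f =1 h.
Proof.
move=> lf lh eL eI; apply: glie_ind => [|c a x IH|c a x IH].
- by rewrite !lin0.
- by rewrite lf lh eL IH.
- by rewrite lf lh eI IH.
Qed.

Lemma lie_gIL a b : [lie gI a, gL b] = (lambda * val b - val a) *: gI (a + b).
Proof. by rewrite lie_anti lie_gLI -scaleNr opprB [b + a]addrC. Qed.

Lemma lie_expand x y : [lie x, y] =
  \sum_(i <- msupp (x : {malg K[_]})) \sum_(j <- msupp (y : {malg K[_]}))
    (mcoeff i x * mcoeff j y) *: gbr lambda i j.
Proof. by []. Qed.

(** With [lc_lie0] below: the span of the [I_a] is an abelian ideal. *)
Lemma lie_lc0 x y : (forall a, lc x a = 0) -> (forall a, lc y a = 0) ->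
  [lie x, y] = 0.
Proof.
move=> x0 y0; rewrite lie_expand big1 // => -[a|a] _; rewrite big1 //.
- by move=> j _; rewrite [mcoeff _ x]x0 mul0r scale0r.
move=> [b|b] _; last by rewrite scaler0.
by rewrite [mcoeff _ y]y0 mulr0 scale0r.
Qed.

Lemma lc_lie x y c : lc [lie x, y] c =
  \sum_(i <- msupp (x : {malg K[_]})) \sum_(j <- msupp (y : {malg K[_]}))
    match i, j with
    | inl a, inl b => lc x a * lc y b * (val b - val a) * (a + b == c)%:R
    | _, _ => 0
    end.
Proof.
rewrite lie_expand lc_sum; apply: eq_bigr => i _.
rewrite lc_sum; apply: eq_bigr => j _.
by case: i j => [a|a] [b|b] /=; rewrite !lcE ?mulr0 ?oppr0 ?mulr0 // mulrA.
Qed.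

Lemma lc_lie0 x y : (forall a, lc x a = 0) -> forall a, lc [lie x, y] a = 0.
Proof.
move=> x0 c; rewrite lc_lie big1 // => -[a|a] _; rewrite big1 // => -[b|b] _ //.
by rewrite x0 !mul0r.
Qed.

Lemma lie_gL0 a : [lie gL 0, gL a] = val a *: gL a.
Proof. by rewrite lie_gLL val_subgrp0 subr0 add0r. Qed.

Lemma lie_gL0I a : [lie gL 0, gI a] = val a *: gI a.
Proof. by rewrite lie_gLI val_subgrp0 mulr0 subr0 add0r. Qed.

Lemma ad_diagonalizable_gL0 : ad_diagonalizable (gL 0).
Proof.
move=> y.
exists [seq mcoeff i y *: basis_vec i | i <- msupp (y : {malg K[_]})].
  move=> _ /mapP[[a|a] _ ->]; exists (val a).
  - by rewrite lieZr lie_gL0 !scalerA mulrC.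
  - by rewrite lieZr lie_gL0I !scalerA mulrC.
by rewrite big_map -glie_expand.
Qed.

End Coefficients.

(** * Group orders and diagonalizable elements *)

Section Cone.
Variable V : zmodType.
Implicit Types (pos : pred V) (s : seq V).

(** The strictly positive elements of a total group order. *)
Definition positive_cone pos :=
  [/\ forall a b, pos a -> pos b -> pos (a + b),
      forall a, pos a -> ~~ pos (- a) &
      forall a, a != 0 -> pos a || pos (- a)].

Lemma positive_cone_opp pos :
  positive_cone pos -> positive_cone (fun a => pos (- a)).
Proof.
move=> [pD pN pT]; split=> [a b pa pb|a|a a0].
- by rewrite opprD pD.
- by rewrite opprK; apply: contraL => /pN.
- by rewrite opprK orbC pT.
Qed.

Lemma positive_cone0 pos : positive_cone pos -> ~~ pos 0.
Proof.
by case=> _ pN _; apply/negP => p0; have := pN _ p0; rewrite oppr0 p0.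
Qed.

Lemma max_in_seq pos s : positive_cone pos -> s != [::] ->
  exists2 m, m \in s & forall a, a \in s -> a = m \/ pos (m - a).
Proof.
move=> [pD pN pT]; elim: s => // x s IH _.
have [->|s0] := eqVneq s [::].
  by exists x => [|a]; rewrite inE //; move=> /eqP; left.
have [m ms mM] := IH s0; have [pxm|npxm] := boolP (pos (x - m)).
  exists x => [|a]; first by rewrite inE eqxx.
  rewrite inE => /predU1P[->|/mM[->|pma]]; [by left|by right|right].
  by rewrite -(subrKA m); apply: pD.
exists m => [|a]; first by rewrite inE ms orbT.
rewrite inE => /predU1P[->|/mM] //.
have [->|xm] := eqVneq x m; [by left|right].
by have := pT (x - m); rewrite subr_eq0 (negPf npxm) opprB => /(_ xm).
Qed.

End Cone.

(** The lexicographic order on real and imaginary parts is a group order on the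
    complex numbers. *)
Lemma complex_positive_cone (R : realType) (G : zmodClosed R[i]) :
  exists pos, @positive_cone (subgrp G) pos.
Proof.
pose re := @complex.Re R; pose im := @complex.Im R.
pose p z := (0 < re z) || (re z == 0) && (0 < im z).
exists (fun a => p (val a)).
have reD z w : re (z + w) = re z + re w by case: z w => ? ? [? ?].
have imD z w : im (z + w) = im z + im w by case: z w => ? ? [? ?].
have reN z : re (- z) = - re z by case: z.
have imN z : im (- z) = - im z by case: z.
split=> [a b|a|a]; rewrite ?val_subgrpD ?val_subgrpN /p /= ?reD ?imD ?reN ?imN.
- case/orP=> [a0|/andP[/eqP a0 a1]] /orP[b0|/andP[/eqP b0 b1]].
  + by rewrite addr_gt0.
  + by rewrite b0 addr0 a0.
  + by rewrite a0 add0r b0.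
  + by rewrite a0 b0 addr0 eqxx addr_gt0 ?orbT.
- rewrite !oppr_gt0 oppr_eq0; case/orP=> [a0|/andP[/eqP a0 a1]].
  + by rewrite ltNge (ltW a0) gt_eqF.
  + by rewrite a0 ltxx eqxx /= -leNgt ltW.
- rewrite !oppr_gt0 oppr_eq0 -val_subgrp_eq0.
  rewrite eq_complex /= negb_and.
  rewrite -/(re _) -/(im _); case: (ltrgt0P (re _)) => //= _.
  by case: (ltrgt0P (im _)).
Qed.

Section Diagonalizable.
Variables (K : numFieldType) (G : zmodClosed K) (lambda : K).

Local Notation g := (glie G lambda).
Local Notation S := (subgrp G).
Local Notation gL := (@gL K G lambda).
Local Notation gI := (@gI K G lambda).
Implicit Types (x y z : g) (a b c : S) (pos : pred S).

Lemma top_lc pos x a0 : positive_cone pos -> lc x a0 != 0 ->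
  exists2 m, lc x m != 0 & forall a, lc x a != 0 -> a = m \/ pos (m - a).
Proof.
move=> pC xa0.
pose s := pmap (fun i : S + S => if i is inl a then Some a else None)
  (msupp (x : {malg K[_]})).
have sE a : (a \in s) = (lc x a != 0).
  rewrite /lc mcoeff_neq0 mem_pmap; apply/mapP/idP => [[[b|//] bs [->]]//|].
  by exists (inl a).
have [|m] := max_in_seq pC (_ : s != [::]).
  by apply: contraTneq xa0 => s0; rewrite -sE s0.
by rewrite sE => ms mM; exists m => // a; rewrite -sE; apply: mM.
Qed.

Lemma lc_lie_top pos x y m n : positive_cone pos ->
    (forall a, lc x a != 0 -> a = m \/ pos (m - a)) ->
    (forall b, lc y b != 0 -> b = n \/ pos (n - b)) ->
    lc x m != 0 -> lc y n != 0 ->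
  lc [lie x, y] (m + n) = lc x m * lc y n * (val n - val m).
Proof.
move=> pC xm yn xm0 yn0; have p0 := positive_cone0 pC.
have top a b : lc x a != 0 -> lc y b != 0 -> a + b = m + n -> a = m /\ b = n.
  move=> /xm[->|pa] /yn[->|pb] e //.
  - by move/addrI: e => ->.
  - by move/addIr: e => ->.
  have [pD _ _] := pC; have := pD _ _ pa pb.
  by rewrite addrACA -opprD e subrr (negPf p0).
rewrite lc_lie (bigD1_seq (inl m)) ?fset_uniq -?mcoeff_neq0 //=.
rewrite (bigD1_seq (inl n)) ?fset_uniq -?mcoeff_neq0 //= eqxx mulr1.
rewrite !big1 ?addr0 // => -[b|b] nb //.
- rewrite big1 // => -[d|d] _ //; have [e|] := eqVneq; last by rewrite mulr0.
  have [->|xb] := eqVneq (lc x b) 0; first by rewrite !mul0r.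
  have [->|yd] := eqVneq (lc y d) 0; first by rewrite mulr0 !mul0r.
  by have [bm _] := top _ _ xb yd e; rewrite bm eqxx in nb.
- by rewrite big1.
by have [/addrI bn|] := eqVneq; [rewrite bn eqxx in nb | rewrite mulr0].
Qed.

(** The top term of an eigenvector [v] of [ad x], of degree [n], brackets with
    the top term of [x], of degree [M > 0], into degree [M + n > n], where
    [mu v] has no coefficient. So [n = M], and the eigenvectors do not span
    [L_2M]. *)
Lemma ad_diagonalizable_top pos x m : positive_cone pos ->
  ad_diagonalizable x -> lc x m != 0 -> ~~ pos m.
Proof.
move=> pC dx xm; apply/negP => pm; have [pD pN pT] := pC.
have p0 := positive_cone0 pC.
have [M xM Mtop] := top_lc pC xm.
have pM : pos M.
  by case: (Mtop _ xm) => [<-//|pMm]; rewrite -(subrK m M) pD.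
have [s sE e] := dx (gL (M + M)).
have [v vs vMM] : exists2 v, v \in s & lc v (M + M) != 0.
  apply/hasP; apply/negPn/negP => /hasPn s0.
  have /eqP := lc_gL lambda (M + M) (M + M); rewrite e lc_sum eqxx big_seq big1.
    by rewrite eq_sym oner_eq0.
  by move=> v /s0; rewrite negbK => /eqP.
have [mu emu] := sE v vs.
have [n vn ntop] := top_lc pC vMM.
have nM : n != M.
  apply/eqP => nM; case: (ntop _ vMM); rewrite nM.
    by rewrite -[RHS]addr0 => /addrI M0; rewrite M0 (negPf p0) in pM.
  by rewrite opprD addNKr => pNM; move: (pN _ pM); rewrite pNM.
have /eqP : lc [lie x, v] (M + n) = mu * lc v (M + n) by rewrite emu lcE.
rewrite (lc_lie_top pC Mtop ntop) //.
have [v0|/ntop[/eqP|]] := eqVneq (lc v (M + n)) 0.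
- rewrite v0 mulr0 !mulf_eq0 (negPf xM) (negPf vn) subr_eq0 /=.
  by rewrite (inj_eq val_inj) (negPf nM).
- by rewrite -subr_eq0 addrK => /eqP M0; rewrite M0 (negPf p0) in pM.
- by rewrite opprD addrCA subrr addr0 => pNM; move: (pN _ pM); rewrite pNM.
Qed.

Lemma ad_diagonalizable_lc pos x m : positive_cone pos ->
  ad_diagonalizable x -> m != 0 -> lc x m = 0.
Proof.
move=> pC dx m0; apply/eqP/negPn/negP => xm; have [_ _ pT] := pC.
have := pT _ m0; rewrite (negPf (ad_diagonalizable_top pC dx xm)).
by rewrite (negPf (ad_diagonalizable_top (positive_cone_opp pC) dx xm)).
Qed.

End Diagonalizable.

(** * Straightening by inner automorphisms *)

Section Straightening.
Variables (K : fieldType) (G : zmodClosed K) (lambda : K).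

Local Notation g := (glie G lambda).
Local Notation S := (subgrp G).
Local Notation gL := (@gL K G lambda).
Local Notation gI := (@gI K G lambda).
Implicit Types (x y z : g) (a b d : S) (zeta c : K).

Lemma exp_ad_gI t d :
  let E x := x + t *: [lie gI d, x] in
  is_exp (fun x => t *: [lie gI d, x]) E /\ lie_iso E.
Proof.
pose D x := t *: [lie gI d, x].
have lD : linear D.
  by move=> k x y; rewrite /D lie_linearr scalerDr !scalerA mulrC.
have DI x a : lc (D x) a = 0.
  by rewrite lcZ lc_lie0 ?mulr0 // => b; rewrite lc_gI.
have DD x : D (D x) = 0.
  by rewrite {1}/D lie_lc0 ?scaler0 // => a; exact: lc_gI.
split; first exact: is_exp_square_zero.
apply: lie_iso_square_zero => // x y.
- by rewrite /D lie_der scalerDr lieZl lieZr.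
- exact: lie_lc0 (DI x) (DI y).
Qed.

(** The term [k I_d] with [d != 0] is removed by [exp (t ad I_d)] with
    [t = k / (zeta d)], since [[I_d, zeta L_0] = - zeta d I_d]; the other terms
    commute with [I_d]. The term [I_0] commutes with [L_0] and is collected in
    [k0]. *)
Lemma inner_straighten_sum zeta k0 (s : seq (S + S)) (k : S + S -> K) :
    zeta != 0 -> (forall a, k (inl a) = 0) ->
  exists sigma : g -> g, [/\ inner_aut sigma, lie_iso sigma &
    exists c, sigma (zeta *: gL 0 + k0 *: gI 0 +
                     \sum_(i <- s) k i *: basis_vec lambda i) =
              zeta *: gL 0 + c *: gI 0].
Proof.
move=> z0 kL; elim: s k0 => [|[a|d] s IH] k0.
- exists id; split; [exact: inner_id | exact: lie_iso_id|].
  by exists k0; rewrite big_nil addr0.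
- have [sigma [i1 i2 [c e]]] := IH k0; exists sigma; split=> //.
  by exists c; rewrite big_cons kL scale0r add0r.
have [->|d0] := eqVneq d 0.
  have [sigma [i1 i2 [c e]]] := IH (k0 + k (inr 0)); exists sigma; split=> //.
  exists c; rewrite -e; congr sigma; rewrite big_cons scalerDl.
  by rewrite -!addrA.
have [sigma [i1 i2 [c e]]] := IH k0.
have vd0 : val d != 0 by rewrite val_subgrp_eq0.
pose t := k (inr d) / (zeta * val d).
have [i3 i4] := exp_ad_gI t d.
exists (sigma \o (fun x => x + t *: [lie gI d, x])); split.
- by apply: inner_comp i1 _; apply: inner_exp i3.
- exact: lie_iso_comp.
exists c; rewrite -e /=; congr sigma.
rewrite big_cons /= -[_ *: gL 0 + _ + _]addrA lieDr.
rewrite [[lie gI d, _ + _]]lie_lc0; first last.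
- move=> b; rewrite !lcD !lcZ !lc_gI !mulr0 !add0r lc_sum big1 // => -[b'|b'] _.
    by rewrite kL scale0r lc0.
  by rewrite lcZ /= lc_gI mulr0.
- by move=> b; rewrite lc_gI.
rewrite addr0 lieZr lie_gIL val_subgrp0 mulr0 sub0r addr0 !scalerA.
have -> : t * zeta * - val d = - k (inr d).
  by rewrite -mulrA mulrN mulrN divfK // mulf_neq0.
rewrite -!addrA scaleNr; congr (_ + (_ + _)).
by rewrite addrC -addrA addNr addr0.
Qed.

Lemma inner_straighten x :
    lc x 0 != 0 -> (forall a, a != 0 -> lc x a = 0) ->
  exists sigma : g -> g, [/\ inner_aut sigma, lie_iso sigma &
    exists c, sigma x = lc x 0 *: gL 0 + c *: gI 0].
Proof.
move=> x0 xa; set zeta := lc x 0 in x0 *.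
pose k (i : S + S) := if i is inr d then ic x d else 0.
have [sigma [i1 i2 [c e]]] :=
  inner_straighten_sum 0 (msupp (x : {malg K[_]})) x0 (k := k) (fun=> erefl).
exists sigma; split=> //; exists c; rewrite -e; congr sigma.
rewrite scale0r addr0; apply: glieP => a.
  rewrite lcD lcZ lc_gL lc_sum big1 ?addr0 => [|[b|b] _].
  - by have [<-|a0] := eqVneq 0 a; rewrite ?mulr1 // mulr0 xa // eq_sym.
  - by rewrite scale0r lc0.
  - by rewrite lcZ lc_gI mulr0.
rewrite icD icZ ic_gL mulr0 add0r.
have /(congr1 (fun y => ic y a)) -> := glie_expand x.
etransitivity; first exact: ic_sum.
apply/esym; etransitivity; first exact: ic_sum.
apply: eq_bigr => -[b|b] _; last exact: erefl.
by transitivity (0 : K); [|apply/esym]; rewrite icZ ic_gL mulr0.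
Qed.

Lemma lc_lie_gL0 y b : lc [lie gL 0, y] b = val b * lc y b.
Proof.
elim/glie_ind: y => [|k a x IH|k a x IH]; first by rewrite lie0r lc0 mulr0.
- rewrite lieDr lcD IH lieZr lie_gL0 scalerA lcZ lcD lcZ lc_gL.
  by have [->|_] := eqVneq a b; rewrite /=; ring.
- by rewrite lieDr lcD IH lieZr lie_gL0I scalerA lcZ lcD lcZ lc_gI; ring.
Qed.

Lemma ic_lie_gL0 y b : ic [lie gL 0, y] b = val b * ic y b.
Proof.
elim/glie_ind: y => [|k a x IH|k a x IH]; first by rewrite lie0r ic0 mulr0.
- by rewrite lieDr icD IH lieZr lie_gL0 scalerA icZ icD icZ ic_gL; ring.
- rewrite lieDr icD IH lieZr lie_gL0I scalerA icZ icD icZ ic_gI.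
  by have [->|_] := eqVneq a b; rewrite /=; ring.
Qed.

Lemma ic_lie_gI0 y b : ic [lie gI 0, y] b = lambda * val b * lc y b.
Proof.
elim/glie_ind: y => [|k a x IH|k a x IH]; first by rewrite lie0r ic0 lc0 mulr0.
- rewrite lieDr icD IH lieZr lie_gIL val_subgrp0 subr0 add0r.
  rewrite scalerA icZ lcD lcZ ic_gI lc_gL.
  by have [->|_] := eqVneq a b; rewrite /=; ring.
- by rewrite lieDr icD IH lieZr lie_gII scaler0 ic0 lcD lcZ lc_gI; ring.
Qed.

(** The [L]-coordinate of [y] in degree [b] is multiplied by [zeta b]. The
    [I]-coordinate receives in addition a multiple of the [L]-coordinate, so it
    decides only where the latter vanishes. *)
Lemma straight_weight zeta c mu y b : zeta != 0 ->
    [lie zeta *: gL 0 + c *: gI 0, y] = mu *: y ->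
  (lc y b != 0) || (ic y b != 0) -> val b = zeta^-1 * mu.
Proof.
move=> z0 e nz; suff -> : mu = zeta * val b by rewrite mulKf.
have el : lc (mu *: y) b = zeta * (val b * lc y b) + c * 0.
  rewrite -e lieDl !lieZl lc_comb; congr (_ * _ + _ * _).
    exact: lc_lie_gL0.
  by apply: lc_lie0 => a; exact: lc_gI.
have ei : ic (mu *: y) b =
    zeta * (val b * ic y b) + c * (lambda * val b * lc y b).
  rewrite -e lieDl !lieZl ic_comb; congr (_ * _ + _ * _).
    exact: ic_lie_gL0.
  exact: ic_lie_gI0.
rewrite lcZ mulr0 addr0 mulrA in el; rewrite icZ mulrA in ei.
have [lcy0|lcy] := eqVneq (lc y b) 0; last exact: mulIf lcy _ _ el.
rewrite lcy0 eqxx /= in nz; rewrite lcy0 !mulr0 addr0 in ei.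
exact: mulIf nz _ _ ei.
Qed.

End Straightening.

Section GL0.
Variables (K : numFieldType) (G G' : zmodClosed K) (lambda lambda' : K).
Variables (pi : glie G lambda -> glie G' lambda').
Hypothesis ipi : lie_iso pi.

(** If the [L]-part of [pi L_0] vanished, [ad (pi L_0)] would square to zero,
    whereas [ad L_0] has the eigenvalue 1. *)
Lemma lc_iso_gL0 pos : positive_cone (V := subgrp G') pos -> 1 \in G ->
  lc (pi (gL lambda 0)) 0 != 0 /\
  forall a, a != 0 -> lc (pi (gL lambda 0)) a = 0.
Proof.
move=> pC G1; pose e : subgrp G := SubGrp G1.
pose x := pi (gL lambda 0); pose y := pi (gL lambda e).
have [lpi mpi _] := ipi.
have xa a : a != 0 -> lc x a = 0.
  apply: ad_diagonalizable_lc pC _.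
  exact: lie_iso_ad_diagonalizable (@ad_diagonalizable_gL0 K G lambda).
split=> //; apply/eqP => x0.
have lx a : lc x a = 0 by have [->|/xa] := eqVneq a 0.
have exy : [lie x, y] = y by rewrite -mpi lie_gL0 scale1r.
have /(lie_iso_injective ipi) eL : y = 0.
  by rewrite -exy lie_lc0 // => a; rewrite -exy lc_lie0.
have /eqP := lc_gL lambda e e; rewrite eL lc0 eqxx.
by rewrite eq_sym oner_eq0.
Qed.

End GL0.

(** * Cocycles of degree zero *)

Section Cocycle.
Variables (K : numFieldType) (G : zmodClosed K).

Local Notation S := (subgrp G).
Implicit Types (a b : S) (c p : S -> K) (l : K).

(** The 1-cocycle condition for [L_a |-> c(a) I_a], with values in the module
    spanned by the [I_a]. *)
Definition weight_cocycle l c := forall a b,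
  c b * (val b - l * val a) - c a * (val a - l * val b) =
    (val b - val a) * c (a + b).

Lemma weight_cocycleB l c p : weight_cocycle l c -> weight_cocycle l p ->
  weight_cocycle l (fun a => c a - p a).
Proof. by move=> hc hp a b; rewrite [RHS]mulrBr -hc -hp; ring. Qed.

Lemma weight_cocycle_const l k : l * k = 0 -> weight_cocycle l (fun=> k).
Proof.
move=> lk a b; apply/eqP; rewrite -subr_eq0; apply/eqP.
by transitivity (l * k * (val b - val a)); [ring | rewrite lk mul0r].
Qed.

Lemma weight_cocycle1 l k : weight_cocycle l (fun a => k * val a).
Proof. by move=> a b; rewrite val_subgrpD; ring. Qed.

Lemma weight_cocycle2 k : weight_cocycle (-1) (fun a => k * val a ^+ 2).
Proof. by move=> a b; rewrite val_subgrpD; ring. Qed.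

Lemma weight_cocycle3 k : weight_cocycle (-2) (fun a => k * val a ^+ 3).
Proof. by move=> a b; rewrite val_subgrpD; ring. Qed.

Lemma subgrp_torsion a : a != 0 -> a != - a /\ a + a != - a.
Proof.
rewrite -val_subgrp_eq0 => a0.
rewrite -!(subr_eq0 _ (- a)) !opprK -!val_subgrp_eq0 !val_subgrpD.
have -> : val a + val a + val a = 3 * val a by ring.
have -> : val a + val a = 2 * val a by ring.
by rewrite !mulf_neq0 ?pnatr_eq0.
Qed.

(** For [a != 0] the pairs [(2a, - a)] and [(a, - a)] have distinct entries, so
    [c(a) = c(2a) + c(- a)] and [0 = c(a) + c(- a)]. *)
Lemma additive_of_distinct c (e : S) : e != 0 ->
  (forall a b, a != b -> c (a + b) = c a + c b) ->
  forall a b, c (a + b) = c a + c b.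
Proof.
move=> e0 H a b; have [<-{b}|/H //] := eqVneq a b.
have c0 : c 0 = 0.
  have := H 0 e; rewrite eq_sym e0 add0r => /(_ isT) /eqP.
  by rewrite -{1}[c e]add0r (inj_eq (addIr _)) eq_sym => /eqP.
have [->|a0] := eqVneq a 0; first by rewrite addr0 c0 addr0.
have [n2 n1] := subgrp_torsion a0.
have h1 := H _ _ n1; rewrite addrK in h1; have h2 := H _ _ n2.
rewrite subrr c0 in h2.
by rewrite {2}h1 addrCA -h2 addr0.
Qed.

(** The multiplicative form of the preceding argument. *)
Lemma character_of_distinct c (e : S) : e != 0 -> (forall a, c a != 0) ->
  (forall a b, a != b -> c (a + b) = c a * c b) -> character c.
Proof.
move=> e0 nz H; split=> // a b; have [<-{b}|/H //] := eqVneq a b.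
have c0 : c 0 = 1.
  have := H 0 e; rewrite eq_sym e0 add0r => /(_ isT) /eqP.
  by rewrite -{1}[c e]mul1r (inj_eq (mulIf (nz e))) eq_sym => /eqP.
have [->|a0] := eqVneq a 0; first by rewrite addr0 c0 mulr1.
have [n2 n1] := subgrp_torsion a0.
have h1 := H _ _ n1; rewrite addrK in h1; have h2 := H _ _ n2.
rewrite subrr c0 in h2.
by rewrite {2}h1 mulrCA -h2 mulr1.
Qed.

Section Solve.
Variables (l : K) (c : S -> K) (e : S).
Hypotheses (hc : weight_cocycle l c) (ve : val e = 1).

Let e0 : e != 0. Proof. by rewrite -val_subgrp_eq0 ve oner_eq0. Qed.

Lemma weight_cocycle_at0 : l * c 0 = 0.
Proof.
have := hc e 0; rewrite val_subgrp0 ve addr0 => h.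
transitivity (- (c 0 * (0 - l * 1) - c e * (1 - l * 0)) - c e); first by ring.
by rewrite h; ring.
Qed.

Lemma weight_cocycle_odd a : l != -1 -> c 0 = 0 -> c (- a) = - c a.
Proof.
move=> l1 c0; have [->|a0] := eqVneq a 0; first by rewrite oppr0 c0 oppr0.
apply/eqP; rewrite -subr_eq0 opprK; apply/eqP.
have k0 : - ((l + 1) * val a) != 0.
  by rewrite oppr_eq0 mulf_neq0 ?val_subgrp_eq0 // addr_eq0.
apply: (mulfI k0); have := hc a (- a); rewrite subrr c0 mulr0 val_subgrpN mulr0.
by move=> <-; ring.
Qed.

(** As [c] is odd, the relations for [(a, b)] and [(a + b, - b)] both involve
    only [c(a)], [c(b)] and [c(a + b)]. Eliminating [c(a + b)] leaves
    [(l - 1) (l + 2) b (a c(b) - b c(a)) = 0], used here with [b = 1]. *)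
Lemma weight_cocycle_generic a : l != 1 -> l != -1 -> l != -2 -> c 0 = 0 ->
  c a = c e * val a.
Proof.
move=> l1 l2 l3 c0; have := hc a e; have := hc (a + e) (- e).
rewrite addrK weight_cocycle_odd // val_subgrpD val_subgrpN ve.
move: (c e) (c a) (c (a + e)) (val a) => ce ca cae va E2 E1.
have k0 : (l - 1) * (l + 2) != 0.
  by rewrite mulf_neq0 ?subr_eq0 ?addr_eq0.
apply/eqP; rewrite eq_sym -subr_eq0; apply/eqP/(mulfI k0); rewrite mulr0.
transitivity ((1 - va) *
    (- ce * (- 1 - l * (va + 1)) - cae * (va + 1 - l * - 1)
      - (- 1 - (va + 1)) * ca)
  - (va + 1 + l) * (ce * (1 - l * va) - ca * (va - l * 1) - (1 - va) * cae)).
  by ring.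
by rewrite E1 E2; ring.
Qed.

End Solve.

(** With [x = c(a + 1)], the pairs [(a, 1)] and [(a + 1, - 1)] give
    [(1 - a) x = - (a + 1) c(a)] and [a x = (a + 2) c(a)], whose combination
    without [x] is [2 c(a) = 0]. *)
Lemma weight_cocycle_m1 c e a : val e = 1 -> weight_cocycle (-1) c ->
  c e = 0 -> c (- e) = 0 -> c a = 0.
Proof.
move=> ve hc ce cNe; have := hc a e; have := hc (a + e) (- e).
rewrite addrK ce cNe val_subgrpD val_subgrpN ve.
move: (c a) (c (a + e)) (val a) => C X v E2 E1.
have k0 : 2 != 0 :> K by rewrite pnatr_eq0.
apply: (mulfI k0); rewrite mulr0.
transitivity
 ((1 - v) * (0 * (- 1 - -1 * (v + 1)) - X * (v + 1 - -1 * - 1)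
              - (- 1 - (v + 1)) * C)
  - v * (0 * (1 - -1 * v) - C * (v - -1 * 1) - (1 - v) * X)); first by ring.
by rewrite E1 E2; ring.
Qed.

(** The pairs [(a, 1)], [(a + 1, 1)] and [(a, 2)] are three linear equations in
    [c(a)], [c(a + 1)] and [c(a + 2)] whose determinant is, up to sign, 12. *)
Lemma weight_cocycle_m2 c e a : val e = 1 -> weight_cocycle (-2) c ->
  c e = 0 -> c (e + e) = 0 -> c a = 0.
Proof.
move=> ve hc ce c2e; have := hc a e; have := hc (a + e) e; have := hc a (e + e).
rewrite addrA ce c2e !val_subgrpD ve.
move: (c a) (c (a + e)) (c (a + e + e)) (val a) => C X Y v E3 E2 E1.
have k0 : -12 != 0 :> K by rewrite oppr_eq0 pnatr_eq0.
apply: (mulfI k0); rewrite mulr0.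
transitivity
 ((v - 1) * v * (0 * (1 + 1 - -2 * v) - C * (v - -2 * (1 + 1))
                  - (1 + 1 - v) * Y)
  - (v - 1) * (v - 2) * (0 * (1 - -2 * (v + 1)) - X * (v + 1 - -2 * 1)
                  - (1 - (v + 1)) * Y)
  - (v + 3) * (v - 2) * (0 * (1 - -2 * v) - C * (v - -2 * 1) - (1 - v) * X)).
  by ring.
by rewrite E1 E2 E3; ring.
Qed.

(** Subtracting from [c] a suitable combination of the known solutions reduces
    each case to a vanishing result. *)
Lemma weight_cocycle_classification l c (e : S) :
  weight_cocycle l c -> val e = 1 ->
  exists (l0 l1 l2 l3 : K) (f : {additive S -> K}), forall a,
    c a = l0 * (l == 0)%:R + l1 * val a + l2 * val a ^+ 2 * (l == -1)%:R
          + l3 * val a ^+ 3 * (l == -2)%:R + f a * (l == 1)%:R.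
Proof.
move=> hc ve.
pose f0 : {additive S -> K} := @GRing.null_fun S K.
have [l1|l1] := eqVneq l 1.
  have e0 : e != 0 by rewrite -val_subgrp_eq0 ve oner_eq0.
  have cD : forall a b, c (a + b) = c a + c b.
    apply: additive_of_distinct e0 _ => a b ab.
    have k0 : val b - val a != 0 by rewrite subr_eq0 (inj_eq val_inj) eq_sym.
    by apply: (mulfI k0); rewrite -hc l1; ring.
  have cB : zmod_morphism c.
    by move=> a b; have := cD (a - b) b; rewrite subrK => ->; rewrite addrK.
  pose f : {additive S -> K} := HB.pack c (GRing.isZmodMorphism.Build S K c cB).
  by exists 0, 0, 0, 0, f => a; rewrite /= !mul0r !add0r mulr1.
have [l2|l2] := eqVneq l (-1).
  (* [k1 a + k2 a^2] agrees with [c] at 1 and -1. *)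
  pose k1 := (c e - c (- e)) / 2; pose k2 := (c e + c (- e)) / 2.
  exists 0, k1, k2, 0, f0 => a; rewrite /= !mul0r mulr1 add0r !addr0.
  rewrite l2 in hc.
  have := weight_cocycleB (weight_cocycleB hc (weight_cocycle1 _ k1))
    (weight_cocycle2 k2).
  move/(weight_cocycle_m1 a ve) => /= h.
  apply/eqP; rewrite -subr_eq0 opprD addrA; apply/eqP/h.
  - by rewrite ve /k1 /k2; field.
  - by rewrite ?val_subgrpN ve /k1 /k2; field.
have [l3|l3] := eqVneq l (-2).
  (* [k1 a + k3 a^3] agrees with [c] at 1 and 2. *)
  pose k1 := (8 * c e - c (e + e)) / 6; pose k3 := (c (e + e) - 2 * c e) / 6.
  exists 0, k1, 0, k3, f0 => a; rewrite /= !mul0r mulr1 add0r !addr0.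
  rewrite l3 in hc.
  have := weight_cocycleB (weight_cocycleB hc (weight_cocycle1 _ k1))
    (weight_cocycle3 k3).
  move/(weight_cocycle_m2 a ve) => /= h.
  apply/eqP; rewrite -subr_eq0 opprD addrA; apply/eqP/h.
  - by rewrite ve /k1 /k3; field.
  - by rewrite ?val_subgrpD ve /k1 /k3; field.
have c0 := weight_cocycle_at0 hc ve.
have hB := weight_cocycleB hc (weight_cocycle_const c0).
have h := weight_cocycle_generic hB ve _ l1 l2 l3.
exists (c 0), (c e - c 0), 0, 0, f0 => a; rewrite /= !mul0r !addr0 -h ?subrr //.
have [_|l0] := eqVneq l 0; first by rewrite mulr1 addrC subrK.
have -> : c 0 = 0 by apply: (mulfI l0); rewrite c0 mulr0.
by rewrite mul0r add0r subr0.
Qed.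

End Cocycle.

(** * Isomorphisms that straighten [L_0] *)

(** The vectors of degree [u]. Locked, so that they are compared without
    unfolding finitely supported functions. *)
HB.lock Definition homog (K : fieldType) (G : zmodClosed K) (lambda p q : K)
  (u : subgrp G) : glie G lambda := p *: gL lambda u + q *: gI lambda u.

Section GradedImages.
Variables (K : numFieldType) (G : zmodClosed K) (lambda : K).

Local Notation S := (subgrp G).
Local Notation gL := (@gL K G lambda).
Local Notation gI := (@gI K G lambda).
Local Notation homog := (@homog K G lambda).
Implicit Types (a b u v : S) (x : glie G lambda).

Lemma glie_neq0 x : x != 0 -> exists b, (lc x b != 0) || (ic x b != 0).
Proof.
move=> x0; have : msupp (x : {malg K[_]}) != fset0.
  apply: contra_neq x0 => m0.
  by apply: glieP => a; rewrite (lc0, ic0); apply: mcoeff_outdom; rewrite m0.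
case/fset0Pn=> -[b|b] bx; exists b; rewrite ?[lc x b != 0]mcoeff_neq0 ?bx //.
by rewrite orbC [ic x b != 0]mcoeff_neq0 bx.
Qed.

Lemma lc_homog p q u b : lc (homog p q u) b = p * (u == b)%:R.
Proof. by rewrite homog.unlock lc_comb lc_gL lc_gI mulr0 addr0. Qed.

Lemma ic_homog p q u b : ic (homog p q u) b = q * (u == b)%:R.
Proof. by rewrite homog.unlock ic_comb ic_gL ic_gI mulr0 add0r. Qed.

Lemma homog_inj u p q p' q' : homog p q u = homog p' q' u -> p = p' /\ q = q'.
Proof.
move=> e; split.
  have := lc_homog p q u u; rewrite e; have := lc_homog p' q' u u.
  by rewrite eqxx !mulr1 => ->.
have := ic_homog p q u u; rewrite e; have := ic_homog p' q' u u.
by rewrite eqxx !mulr1 => ->.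
Qed.

Lemma homog_add p q p' q' u :
  homog p q u + homog p' q' u = homog (p + p') (q + q') u.
Proof.
apply: glieP => b; first by rewrite lcD !lc_homog mulrDl.
by rewrite icD !ic_homog mulrDl.
Qed.

Lemma homog00 u : homog 0 0 u = 0.
Proof. by rewrite homog.unlock !scale0r addr0. Qed.

Lemma homog_eq0 p q u : homog p q u = 0 -> p = 0 /\ q = 0.
Proof. by rewrite -(homog00 u) => /homog_inj. Qed.

Lemma gL_homog u : gL u = homog 1 0 u.
Proof. by rewrite homog.unlock scale1r scale0r addr0. Qed.

Lemma gI_homog u : gI u = homog 0 1 u.
Proof. by rewrite homog.unlock scale1r scale0r add0r. Qed.

Lemma scale_homog k p q u : k *: homog p q u = homog (k * p) (k * q) u.
Proof.
rewrite homog.unlock.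
exact: etrans (scalerDr _ _ _) (congr2 +%R (scalerA _ _ _) (scalerA _ _ _)).
Qed.

Lemma lie_comb (V : lieAlgType K) (x y x' y' X Y : V) k1 k2 k3 p q p' q' :
    [lie x, x'] = k1 *: X -> [lie x, y'] = k2 *: Y -> [lie y, x'] = k3 *: Y ->
    [lie y, y'] = 0 ->
  [lie p *: x + q *: y, p' *: x' + q' *: y'] =
    (p * p' * k1) *: X + (p * q' * k2 + q * p' * k3) *: Y.
Proof.
move=> e1 e2 e3 e4; rewrite lieDl !lieDr !lieZl !lieZr e1 e2 e3 e4.
by rewrite !scaler0 addr0 !scalerA -addrA scalerDl.
Qed.

Lemma lie_homog p q u p' q' v : [lie homog p q u, homog p' q' v] =
  homog (p * p' * (val v - val u))
      (p * q' * (val v - lambda * val u) + q * p' * (lambda * val v - val u))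
      (u + v).
Proof.
rewrite homog.unlock; apply: lie_comb.
- exact: lie_gLL.
- exact: lie_gLI.
- exact: lie_gIL.
- exact: lie_gII.
Qed.

End GradedImages.

Section StraightIso.
Variables (K : numFieldType) (G G' : zmodClosed K) (lambda lambda' : K).
Variables (rho : glie G lambda -> glie G' lambda') (zeta c0 : K) (e : subgrp G).
Hypotheses (irho : lie_iso rho) (zeta0 : zeta != 0) (ve : val e = 1).
Hypothesis rho0 : rho (gL lambda 0) = homog lambda' zeta c0 0.

Local Notation S := (subgrp G).
Local Notation xi := (zeta^-1).
Implicit Types (a b : S).

Let lrho : linear rho. Proof. by case: irho. Qed.
Let mrho : {morph rho : x y / [lie x, y]}. Proof. by case: irho. Qed.

(* Eigenvectors of [ad L_0] are mapped to eigenvectors of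
   [ad (zeta L_0 + c0 I_0)]. *)
Let weight z a u : [lie gL lambda 0, z] = val a *: z ->
  (lc (rho z) u != 0) || (ic (rho z) u != 0) -> val u = xi * val a.
Proof.
move=> ez; apply: (straight_weight (c := c0) zeta0).
have := rho0; rewrite homog.unlock => <-; rewrite -mrho ez; exact: linZ.
Qed.

Lemma straight_scaled : scaled xi G G'.
Proof.
have [_ _ [g _ gK]] := irho.
move=> z; split=> [zG'|[a aG ->]].
  pose b := SubGrp zG'; pose w := g (gL lambda' b).
  suff [i ib] : exists i, lc (rho (basis_vec lambda i)) b != 0.
    case: i ib => a ab; exists (val a); do ?exact: (valP a).
      by apply: (@weight (gL lambda a) a b); rewrite ?lie_gL0 //; rewrite ab.
    by apply: (@weight (gI lambda a) a b); rewrite ?lie_gL0I //; rewrite ab.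
  suff /hasP[i _ ib] : has (fun i => lc (rho (basis_vec lambda i)) b != 0)
    (msupp (w : {malg K[_]})) by exists i.
  apply/negPn/negP => /hasPn h; have /eqP := lc_gL lambda' b b.
  rewrite eqxx -[gL lambda' b]gK -/w [w]glie_expand lin_sum // lc_sum.
  rewrite big_seq big1 ?[0 == _]eq_sym ?oner_eq0 // => i /h.
  by rewrite negbK linZ // lcZ => /eqP ->; rewrite mulr0.
pose a' := SubGrp aG.
have /glie_neq0[u] : rho (gL lambda a') != 0.
  apply/eqP => /(lie_iso_injective irho) eL.
  by move: eL; rewrite gL_homog => /homog_eq0[/eqP]; rewrite oner_eq0.
by move/(weight (lie_gL0 _ a')) => /= <-; apply: (valP u).
Qed.

Let hP a : xi * val a \in G'.
Proof. apply/straight_scaled; exists (val a) => //; exact: (valP a). Qed.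

Let h a : subgrp G' := SubGrp (hP a).

Let vh a : val (h a) = xi * val a. Proof. by []. Qed.

Let hD a b : h (a + b) = h a + h b.
Proof. by apply: val_inj; rewrite val_subgrpD !vh val_subgrpD mulrDr. Qed.

Let rho_homog z a : [lie gL lambda 0, z] = val a *: z ->
  rho z = homog lambda' (lc (rho z) (h a)) (ic (rho z) (h a)) (h a).
Proof.
move=> ez.
have wt u : u != h a -> lc (rho z) u = 0 /\ ic (rho z) u = 0.
  move=> uh; have : ~~ ((lc (rho z) u != 0) || (ic (rho z) u != 0)).
    by apply: contra uh => /(weight ez) vu; apply/eqP/val_inj; rewrite vu.
  by rewrite negb_or !negbK => /andP[/eqP -> /eqP ->].
apply: glieP => u.
  rewrite lc_homog; have [->|nu] := eqVneq (h a) u; first by rewrite mulr1.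
  by rewrite mulr0; case: (wt u); rewrite 1?eq_sym.
rewrite ic_homog; have [->|nu] := eqVneq (h a) u; first by rewrite mulr1.
by rewrite mulr0; case: (wt u); rewrite 1?eq_sym.
Qed.

Let p a := lc (rho (gL lambda a)) (h a).
Let q a := ic (rho (gL lambda a)) (h a).
Let r a := lc (rho (gI lambda a)) (h a).
Let m a := ic (rho (gI lambda a)) (h a).

Let rhoL a : rho (gL lambda a) = homog lambda' (p a) (q a) (h a).
Proof. by apply: rho_homog; rewrite lie_gL0. Qed.

Let rhoI a : rho (gI lambda a) = homog lambda' (r a) (m a) (h a).
Proof. by apply: rho_homog; rewrite lie_gL0I. Qed.

Let relLL a b :
  p a * p b * (val (h b) - val (h a)) = (val b - val a) * p (a + b) /\
  p a * q b * (val (h b) - lambda' * val (h a)) +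
    q a * p b * (lambda' * val (h b) - val (h a)) = (val b - val a) * q (a + b).
Proof.
have := mrho (gL lambda a) (gL lambda b).
by rewrite lie_gLL linZ // !rhoL scale_homog lie_homog -hD => /homog_inj[-> ->].
Qed.

Let relLI a b :
  p a * r b * (val (h b) - val (h a)) = (val b - lambda * val a) * r (a + b) /\
  p a * m b * (val (h b) - lambda' * val (h a)) +
    q a * r b * (lambda' * val (h b) - val (h a)) =
    (val b - lambda * val a) * m (a + b).
Proof.
have := mrho (gL lambda a) (gI lambda b).
rewrite lie_gLI linZ // rhoL !rhoI scale_homog lie_homog -hD.
by case/homog_inj=> -> ->.
Qed.

Let relII a b : r a * r b * (val (h b) - val (h a)) = 0.
Proof.
have := lie_gII lambda a b; move/(congr1 rho).
by rewrite mrho !rhoI lie_homog lin0 // => /homog_eq0[].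
Qed.

Let xi0 : xi != 0. Proof. by rewrite invr_eq0. Qed.

Let vhB a b : val (h b) - val (h a) = xi * (val b - val a).
Proof. by rewrite !vh mulrBr. Qed.

Let nz_vhB a b : a != b -> val (h b) - val (h a) != 0.
Proof.
by move=> ab; rewrite vhB mulf_neq0 // subr_eq0 (inj_eq val_inj) eq_sym.
Qed.

(** By [relII] at most one [r b] is nonzero. If one is, then bracketing with
    [I_b] forces [p a = 0] for all other nonzero [a]. With [2d] and [3d] among
    them, the images of [L_2d] and [L_3d] commute, so [L_5d] is mapped to 0. *)
Let r0 b : r b = 0.
Proof.
apply/eqP/negPn/negP => rb.
have r_other a : a != b -> r a = 0.
  move=> ab; have /eqP := relII a b.
  by rewrite !mulf_eq0 (negPf rb) (negPf (nz_vhB ab)) !orbF => /eqP.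
have p_other a : a != b -> a != 0 -> p a = 0.
  move=> ab a0; have [/eqP] := relLI a b.
  rewrite (r_other (a + b)); last by rewrite -subr_eq0 addrK.
  by rewrite mulr0 !mulf_eq0 (negPf rb) (negPf (nz_vhB ab)) !orbF => /eqP.
(* A nonzero element such that [2d] and [3d] differ from 0 and [b]. *)
pose d := if b == 0 then e else b.
have vd : val d != 0.
  rewrite /d; have [_|] := eqVneq b 0; last by rewrite val_subgrp_eq0.
  by rewrite ve oner_eq0.
have bd n : d *+ n.+2 != b /\ d *+ n.+2 != 0.
  have n0 k : d *+ k.+1 != 0.
    by rewrite -val_subgrp_eq0 raddfMn /= mulrn_eq0 negb_or.
  split=> //; have [->|b0] := eqVneq b 0; first exact: n0.
  have db : d = b by rewrite /d (negPf b0).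
  by rewrite -db mulrS -subr_eq0 addrAC subrr add0r.
have [[b2 z2] [b3 z3]] := (bd 0, bd 1).
have [] := relLL (d *+ 2) (d *+ 3);
  rewrite (p_other _ b2 z2) (p_other _ b3 z3) !(mulr0, mul0r) addr0.
have k0 : val (d *+ 3) - val (d *+ 2) != 0.
  by rewrite subr_eq0 (inj_eq val_inj) mulrS -subr_eq0 addrK -val_subgrp_eq0.
move=> /esym/eqP; rewrite mulf_eq0 (negPf k0) => /eqP p0.
move=> /esym/eqP; rewrite mulf_eq0 (negPf k0) => /eqP q0.
have /(lie_iso_injective irho) eL : rho (gL lambda (d *+ 2 + d *+ 3)) = 0.
  by rewrite rhoL p0 q0 homog00.
by move: eL; rewrite gL_homog => /homog_eq0[/eqP]; rewrite oner_eq0.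
Qed.

Let m_neq0 a : m a != 0.
Proof.
apply/eqP => m0; have /(lie_iso_injective irho) : rho (gI lambda a) = 0.
  by rewrite rhoI r0 m0 homog00.
by rewrite gI_homog => /homog_eq0[_ /eqP]; rewrite oner_eq0.
Qed.

(** Otherwise [L_a] and [I_a], which are independent, would both be mapped into
    the line of [I_(xi a)]. *)
Let p_neq0 a : p a != 0.
Proof.
apply/eqP => p0.
have : rho (m a *: gL lambda a + (- q a) *: gI lambda a) = 0.
  rewrite linD // linZ // linZ // rhoL rhoI p0 r0 !scale_homog homog_add.
  by rewrite !mulr0 addr0 mulNr [q a * _]mulrC subrr homog00.
move/(lie_iso_injective irho); have := m_neq0 a.
rewrite gL_homog gI_homog !scale_homog homog_add => /eqP m0 /homog_eq0[].
by rewrite mulr1 mulr0 addr0.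
Qed.

Let chi a := xi * p a.

Let chi_neq0 a : chi a != 0. Proof. exact: mulf_neq0. Qed.

Let pE a : p a = zeta * chi a. Proof. by rewrite /chi mulVKf. Qed.

Let chi_char : character chi.
Proof.
have e0 : e != 0 by rewrite -val_subgrp_eq0 ve oner_eq0.
apply: (character_of_distinct e0) => // a b ab.
have k0 : val b - val a != 0 by rewrite subr_eq0 (inj_eq val_inj) eq_sym.
apply: (mulfI k0); have [eLL _] := relLL a b.
by rewrite /chi mulrCA -eLL vhB; ring.
Qed.

Let chiM a b : chi (a + b) = chi a * chi b. Proof. by case: chi_char. Qed.

Let q_cocycle : weight_cocycle lambda' (fun a => q a / chi a).
Proof.
move=> a b; have [_ eLL] := relLL a b.
apply: (mulfI (chi_neq0 (a + b))).
transitivity ((val b - val a) * q (a + b)); last first.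
  by rewrite mulrCA [chi _ * _]mulrC divfK.
rewrite -eLL chiM !pE !vh; have := chi_neq0 a; have := chi_neq0 b.
move: (chi a) (chi b) (q a) (q b) (val a) (val b) => ca cb qa qb va vb b0 a0.
by field; rewrite zeta0 a0 b0.
Qed.

Let m_rel a b : chi a * m b * (val b - lambda' * val a) =
                (val b - lambda * val a) * m (a + b).
Proof.
have [_ <-] := relLI a b; rewrite r0 mulr0 mul0r addr0 pE !vh.
by field.
Qed.

Lemma straight_normal_form : exists chi c m : S -> K,
  [/\ character chi, weight_cocycle lambda' c, forall a, m a != 0,
   forall a b, chi a * m b * (val b - lambda' * val a) =
               (val b - lambda * val a) * m (a + b) &
   forall a (u : subgrp G'), val u = xi * val a ->
     rho (gL lambda a) =
       (zeta * chi a) *: gL lambda' u + (chi a * c a) *: gI lambda' u /\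
     rho (gI lambda a) = m a *: gI lambda' u].
Proof.
exists chi, (fun a => q a / chi a), m; split=> // a u eu.
have -> : u = h a by apply: val_inj.
rewrite rhoL rhoI r0 -pE mulrCA divff // mulr1 homog.unlock; split=> //.
by rewrite scale0r add0r.
Qed.

End StraightIso.

(** The case [b = 0] gives [lambda' chi(a) m(0) = lambda m(a)] for [a != 0], so
    [lambda] and [lambda'] vanish together. If they do not vanish, the case
    [a = b = 1] compares [1 - lambda'] with [1 - lambda]. If they do, the pair
    [(- a, a)] gives [chi(- a) m(a) = m(0)]. *)
Lemma weight_module_twist (K : numFieldType) (G : zmodClosed K)
    (lambda lambda' : K) (chi m : subgrp G -> K) (e : subgrp G) :
    val e = 1 -> character chi -> (forall a, m a != 0) ->
    (forall a b, chi a * m b * (val b - lambda' * val a) =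
                 (val b - lambda * val a) * m (a + b)) ->
  lambda' = lambda /\ forall a, m a = m 0 * chi a.
Proof.
move=> ve [chi0 chiM] m0 rel.
have chi1 : chi 0 = 1.
  by have := chiM 0 0; rewrite addr0 -{1}[chi 0]mulr1 => /(mulfI (chi0 0)) <-.
have at0 a : a != 0 -> lambda' * (chi a * m 0) = lambda * m a.
  rewrite -val_subgrp_eq0 => a0.
  have nv0 : - val a != 0 by rewrite oppr_eq0.
  apply: (mulfI nv0); have := rel a 0; rewrite val_subgrp0 addr0 => h.
  transitivity (chi a * m 0 * (0 - lambda' * val a)); first by ring.
  by rewrite h; ring.
have e0 : e != 0 by rewrite -val_subgrp_eq0 ve oner_eq0.
have [ll|l0] := eqVneq lambda 0.
  have l'0 : lambda' = 0.
    have /eqP := at0 e e0; rewrite ll mul0r !mulf_eq0.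
    by rewrite (negPf (chi0 e)) (negPf (m0 0)) !orbF => /eqP.
  rewrite l'0; split=> // a; have [->|a0] := eqVneq a 0.
    by rewrite chi1 mulr1.
  have va0 : val a != 0 by rewrite val_subgrp_eq0.
  have := rel (- a) a; rewrite ll l'0 !mul0r !subr0 addNr [_ * val a]mulrC.
  by move=> /(mulfI va0) <-; rewrite mulrAC -chiM addNr chi1 mul1r.
have ll : lambda' = lambda.
  have ee0 : e + e != 0.
    by rewrite -val_subgrp_eq0 val_subgrpD ve (pnatr_eq0 K 2).
  have e1 := at0 e e0; have e2 := at0 _ ee0; have e3 := rel e e.
  rewrite ve !mulr1 in e3; rewrite chiM in e2.
  have k0 : lambda * m (e + e) != 0 by rewrite mulf_neq0.
  have e4 : lambda * m (e + e) * (1 - lambda') =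
            lambda * m (e + e) * (1 - lambda).
    rewrite -[RHS]mulrA [m _ * _]mulrC -e3 -e2.
    transitivity (chi e * (lambda' * (chi e * m 0)) * (1 - lambda')).
      by ring.
    by rewrite e1; ring.
  by move/(mulfI k0): e4 => /addrI/oppr_inj.
split=> // a; have [->|a0] := eqVneq a 0; first by rewrite chi1 mulr1.
by apply: (mulfI l0); rewrite -at0 // ll [m 0 * _]mulrC.
Qed.

Section NormalForm.
Variables (K : numFieldType) (G G' : zmodClosed K) (lambda lambda' : K).
Variables (pi : glie G lambda -> glie G' lambda') (pos : pred (subgrp G')).

Lemma lie_iso_normal_form : 1 \in G -> positive_cone pos -> lie_iso pi ->
  exists xi : K, [/\ xi != 0, scaled xi G G', lambda' = lambda &
  exists sigma, inner_aut sigma /\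
  exists (l : K) (chi c : subgrp G -> K),
    [/\ l != 0, character chi, weight_cocycle lambda c &
     forall a (u : subgrp G'), val u = xi * val a ->
       sigma (pi (gL lambda a)) =
         (xi^-1 * chi a) *: gL lambda' u + (chi a * c a) *: gI lambda' u /\
       sigma (pi (gI lambda a)) = (l * chi a) *: gI lambda' u]].
Proof.
move=> G1 pC ipi; pose e : subgrp G := SubGrp G1.
have [z0 za] := lc_iso_gL0 ipi pC G1.
have [sigma [isig lsig [c0 sE]]] := inner_straighten z0 za.
set zeta := lc _ _ in z0 sE; pose rho := sigma \o pi.
have irho : lie_iso rho by apply: lie_iso_comp.
have rho0 : rho (gL lambda 0) = homog lambda' zeta c0 0 by rewrite homog.unlock.
have ve : val e = 1 by [].
have sc := straight_scaled irho z0 rho0.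
have [chi [c [m [chiP cP m0 rel nf]]]] := straight_normal_form irho z0 ve rho0.
have [ll mE] := weight_module_twist ve chiP m0 rel.
exists zeta^-1; split=> //; first by rewrite invr_eq0.
exists sigma; split; first exact: isig.
exists (m 0), chi, c; split; [exact: m0|exact: chiP|by rewrite -ll|].
by move=> a u /nf[eL eI]; rewrite invrK -mE.
Qed.

End NormalForm.

(** * Rescaling, and the theorem *)

Section LinearExtension.
Variables (K : fieldType) (T : choiceType) (W : lmodType K) (f : T -> W).
Implicit Types x y : {malg K[T]}.

Definition lin_ext x : W := \sum_(i <- msupp x) x@_i *: f i.

Lemma lin_extEw (d : {fset T}) x :
  (msupp x `<=` d)%fset -> lin_ext x = \sum_(i <- d) x@_i *: f i.
Proof.
move=> xd; apply: big_fset_incl => // i _ /mcoeff_outdom ->.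
by rewrite scale0r.
Qed.

Lemma lin_ext_linear : linear lin_ext.
Proof.
move=> k x y; pose d := (msupp (k *: x + y) `|` (msupp x `|` msupp y))%fset.
have s0 : (msupp (k *: x + y) `<=` d)%fset by apply: fsubsetUl.
have s1 : (msupp x `<=` d)%fset by rewrite /d fsetUCA fsubsetUl.
have s2 : (msupp y `<=` d)%fset by rewrite /d fsetUA fsubsetUr.
rewrite (lin_extEw s0) (lin_extEw s1) (lin_extEw s2) scaler_sumr -big_split.
by apply: eq_bigr => i _; rewrite mcoeffD mcoeffZ scalerDl scalerA.
Qed.

Lemma lin_extU i : lin_ext << i >> = f i.
Proof.
by rewrite (lin_extEw msuppU_le) big_seq_fset1 mcoeffUU scale1r.
Qed.

End LinearExtension.

Section GlieExtension.
Variables (K : fieldType) (G : zmodClosed K) (lambda : K) (W : lmodType K).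
Variables (fL fI : subgrp G -> W).

Definition glie_ext (x : glie G lambda) : W :=
  lin_ext (fun i => match i with inl a => fL a | inr a => fI a end) x.

Lemma glie_ext_linear : linear glie_ext. Proof. exact: lin_ext_linear. Qed.

Lemma glie_ext_gL a : glie_ext (gL lambda a) = fL a.
Proof. by rewrite gL.unlock /glie_ext lin_extU. Qed.

Lemma glie_ext_gI a : glie_ext (gI lambda a) = fI a.
Proof. by rewrite gI.unlock /glie_ext lin_extU. Qed.

End GlieExtension.

Lemma linear_comp (K : fieldType) (U V W : lmodType K) (f : V -> W)
    (h : U -> V) :
  linear f -> linear h -> linear (f \o h).
Proof. by move=> lf lh k x y /=; rewrite lh lf. Qed.

(** A linear map is determined on the basis, so the bracket need only be checked
    there; the pair [(I_a, L_b)] follows by antisymmetry. *)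
Lemma glie_morph (K : fieldType) (G : zmodClosed K) (lambda : K)
    (V : lieAlgType K) (F : glie G lambda -> V) :
    linear F ->
    (forall a b, [lie F (gL lambda a), F (gL lambda b)]
                 = (val b - val a) *: F (gL lambda (a + b))) ->
    (forall a b, [lie F (gL lambda a), F (gI lambda b)]
                 = (val b - lambda * val a) *: F (gI lambda (a + b))) ->
    (forall a b, [lie F (gI lambda a), F (gI lambda b)] = 0) ->
  {morph F : x y / [lie x, y]}.
Proof.
move=> lF FLL FLI FII x y; move: x.
apply: (glie_lin_eq (linear_comp lF (lie_linearl y))
                    (linear_comp (lie_linearl (F y)) lF)) => a.
  move: y; apply: (glie_lin_eq (linear_comp lF (lie_linearr _))
                    (linear_comp (lie_linearr _) lF)) => b /=.
    by rewrite FLL lie_gLL linZ.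
  by rewrite FLI lie_gLI linZ.
move: y; apply: (glie_lin_eq (linear_comp lF (lie_linearr _))
                    (linear_comp (lie_linearr _) lF)) => b /=.
  by rewrite lie_gIL linZ // [RHS]lie_anti FLI -scaleNr opprB [b + a]addrC.
by rewrite FII lie_gII lin0.
Qed.

Section Rescaling.
Variables (K : fieldType) (G G' : zmodClosed K) (lambda xi : K).
Hypotheses (xi0 : xi != 0) (sc : scaled xi G G').

Lemma scaled_mem (a : subgrp G) : xi * val a \in G'.
Proof. by apply/sc; exists (val a) => //; exact: (valP a). Qed.

Lemma scaled_mem_inv (b : subgrp G') : xi^-1 * val b \in G.
Proof. by have /sc[a aG ->] := valP b; rewrite mulKf. Qed.

Lemma rescaling_iso : exists F : glie G lambda -> glie G' lambda, lie_iso F.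
Proof.
pose h a : subgrp G' := SubGrp (scaled_mem a).
pose k b : subgrp G := SubGrp (scaled_mem_inv b).
have hK : cancel h k by move=> a; apply: val_inj; rewrite /= mulKf.
have kK : cancel k h by move=> a; apply: val_inj; rewrite /= mulVKf.
have hD a b : h (a + b) = h a + h b.
  by apply: val_inj; rewrite val_subgrpD /= mulrDr.
pose F := glie_ext (lambda := lambda)
  (fun a => xi^-1 *: gL lambda (h a)) (fun a => gI lambda (h a)).
pose F' := glie_ext (lambda := lambda)
  (fun b => xi *: gL lambda (k b)) (fun b => gI lambda (k b)).
have lF : linear F by apply: glie_ext_linear.
have lF' : linear F' by apply: glie_ext_linear.
have FL a : F (gL lambda a) = xi^-1 *: gL lambda (h a) by apply: glie_ext_gL.
have FI a : F (gI lambda a) = gI lambda (h a) by apply: glie_ext_gI.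
have F'L b : F' (gL lambda b) = xi *: gL lambda (k b) by apply: glie_ext_gL.
have F'I b : F' (gI lambda b) = gI lambda (k b) by apply: glie_ext_gI.
exists F; split=> //.
  apply: glie_morph => // a b; rewrite ?FL ?FI.
  - rewrite lieZl lieZr lie_gLL !scalerA hD; congr (_ *: _).
    by rewrite /=; field.
  - rewrite lieZl lie_gLI scalerA hD; congr (_ *: _).
    by rewrite /=; field.
  - exact: lie_gII.
exists F'.
  have id_lin : linear (@id (glie G lambda)) by [].
  apply: (glie_lin_eq (linear_comp lF' lF) id_lin) => a /=.
    by rewrite FL linZ // F'L hK scalerA mulVf // scale1r.
  by rewrite FI F'I hK.
have id_lin : linear (@id (glie G' lambda)) by [].
apply: (glie_lin_eq (linear_comp lF lF') id_lin) => a /=.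
  by rewrite F'L linZ // FL kK scalerA mulfV // scale1r.
by rewrite F'I FI kK.
Qed.

End Rescaling.

Theorem theorem4p1 (R : realType) (G G' : zmodClosed R[i])
    (lambda lambda' : R[i])
    (ZG : contains_int G) (nG : no_unit_fraction G)
    (ZG' : contains_int G') (nG' : no_unit_fraction G') :
  ((exists pi : glie G lambda -> glie G' lambda', lie_iso pi) <->
     (lambda' = lambda /\ exists xi : R[i], xi != 0 /\ scaled xi G G'))
  /\
  (forall pi : glie G lambda -> glie G' lambda, lie_iso pi ->
     exists xi : R[i], [/\ xi != 0, scaled xi G G' &
     exists sigma : glie G' lambda -> glie G' lambda, inner_aut sigma /\
     exists (l l0 l1 l2 l3 : R[i]) (chi : subgrp G -> R[i])
            (f : {additive subgrp G -> R[i]}),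
       [/\ l != 0, character chi &
        forall (a : subgrp G) (xia : subgrp G'), val xia = xi * val a ->
          sigma (pi (gL lambda a)) =
            (xi^-1 * chi a) *: gL lambda xia
            + (chi a * (l0 * (lambda == 0)%:R
                        + l1 * val a
                        + l2 * val a ^+ 2 * (lambda == -1)%:R
                        + l3 * val a ^+ 3 * (lambda == -2)%:R
                        + f a * (lambda == 1)%:R)) *: gI lambda xia
          /\ sigma (pi (gI lambda a)) = (l * chi a) *: gI lambda xia]]).
Proof.
have G1 : 1 \in G by have := ZG 1.
split; first split=> [[pi ipi]|[-> [xi [xi0 sc]]]].
- have [pos pC] := complex_positive_cone G'.
  have [xi [xi0 sc ll _]] := lie_iso_normal_form G1 pC ipi.
  by split=> //; exists xi.
- exact: rescaling_iso xi0 sc.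
move=> pi ipi; have [pos pC] := complex_positive_cone G'.
have [xi [xi0 sc _ [sigma [isig]]]] := lie_iso_normal_form G1 pC ipi.
move=> [l [chi [c [l0 chiP cP nf]]]].
have [k0 [k1 [k2 [k3 [f cE]]]]] :=
  weight_cocycle_classification cP (erefl (val (SubGrp G1))).
exists xi; split; [exact: xi0|exact: sc|exists sigma; split; first exact: isig].
exists l, k0, k1, k2, k3, chi, f; split; [exact: l0|exact: chiP|].
by move=> a u /nf; rewrite cE.
Qed.
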